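(* Consider discretizations of an integral equation with elliptic kernel on a quasi-1D domain (a curve in the plane), with $N$ degrees of freedom and a quadtree with levels $0,\dots,L$, $L=\mathcal{O}(\log N)$. Assume that the number of skeletons for a box at level $\ell$, $k_\ell$, grows like $\mathcal{O}(L-\ell)$ as one moves up the tree (i.e. $k_\ell\le c\,(1+L-\ell)$ with $c$ independent of $N$ and $\ell$), in the factorizations of both $G$ and $\bar G$. Suppose that the recursive skeletonization factorization of $G$ is given, and that $\bar G(\mathcal{I}_b,:)\ne G(\mathcal{I}_b,:)$ and $\bar G(:,\mathcal{I}_b)\ne G(:,\mathcal{I}_b)$ only for a collection of $m$ leaf boxes $b$ (childless boxes, on any levels of the tree), in the sense that $\bar G(\mathcal{I},\mathcal{I}')=G(\mathcal{I},\mathcal{I}')$ for all index sets $\mathcal{I},\mathcal{I}'$ disjoint from the union of the sets $\mathcal{I}_b$ over these $m$ boxes. Then constructing the recursive skeletonization factorization of $\bar G$ by the updating algorithm described in the context, from the given factorization of $G$, has complexity $\mathcal{O}(m\log^4 N)$.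
   Context: **Setting.** $G\in\mathbb{C}^{N\times N}$ discretizes (e.g. by collocation at points $x_1,\dots,x_N$) an integral equation $a(x)u(x)+b(x)\int_\Omega K(x,y)c(y)u(y)\,dy=f(x)$, $x\in\Omega$, where $K$ is associated with an elliptic partial differential equation (its Green's function or a derivative of it). $\bar G\in\mathbb{C}^{N\times N}$ discretizes a locally perturbed problem with the same number of degrees of freedom (DOFs) and the same tree. Write $[N]=\{1,\dots,N\}$, and let $A(\mathcal{I},\mathcal{I}')$ denote the submatrix with rows $\mathcal{I}$ and columns $\mathcal{I}'$, a colon standing for all indices. Overbars denote quantities for $\bar G$. **Tree.** A square containing the domain is the root (level $0$) of an adaptive quadtree with levels $0,\dots,L$, $L=\mathcal{O}(\log N)$; leaf boxes are the boxes without children and may occur on different levels; each contains at most $n_{\rm occ}$ DOFs, with $n_{\rm occ}$ independent of $N$; all level-$L$ boxes are leaves. Boxes are adjacent if distinct, with disjoint interiors and intersecting closures. For $b$ on level $\ell$, $\mathrm{nbor}(b)$ is the collection of boxes adjacent to $b$ that are on level $\ell$, or on a level $\ell'<\ell$ and childless. $\mathrm{child}(b)$ and $\mathrm{parent}(b)$ are the children and parent of $b$. For a leaf $b$, $\mathcal{I}_b$ is the set of DOFs located in $b$; for a non-leaf $b$, $\mathcal{I}_b=\bigcup_{b'\in\mathrm{child}(b)}\mathcal{S}_{b'}$ with $\mathcal{S}_{b'}$ as below. $\mathcal{N}_b=\bigcup_{b'\in\mathrm{nbor}(b)}\mathcal{I}_{b'}$, $\mathcal{F}_b=([N]\setminus\mathcal{I}_b)\setminus\mathcal{N}_b$,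 and $\mathcal{F}_b^c=\mathcal{I}_b\cup\mathcal{N}_b$. $\mathscr{L}_\ell$ is the collection of all $\mathcal{I}_b$ with $b$ on level $\ell$. **Interpolative decomposition (ID).** An $\epsilon$-accurate ID of a matrix $A$ with columns indexed by $\mathcal{I}$ is a partition $\mathcal{I}=\mathcal{S}\cup\mathcal{R}$ (skeleton and redundant columns) and a matrix $T$ with $A(:,\mathcal{R})=A(:,\mathcal{S})T+E$, $\|E\|_2\le\epsilon\|A\|_2$. **Skeletonization of $A$ with respect to $\mathcal{I}$.** With $\mathcal{I}^c$ the complement of $\mathcal{I}$, compute an ID ($\mathcal{S},\mathcal{R},T$) of $A(\mathcal{I}^c,\mathcal{I})$ stacked on $A(\mathcal{I},\mathcal{I}^c)^*$. Ordering the indices as $(\mathcal{I}^c,\mathcal{S},\mathcal{R})$, let $Q$ be the identity with additional $(\mathcal{S},\mathcal{R})$ block $-T$, and (neglecting the ID error) let $D_{\mathcal{S},\mathcal{R}},D_{\mathcal{R},\mathcal{S}},D_{\mathcal{R},\mathcal{R}}$ be the corresponding blocks of $Q^*AQ$, with $D_{\mathcal{R},\mathcal{R}}$ assumed nonsingular. Block elimination of $\mathcal{R}$ gives $D_{\mathcal{S},\mathcal{S}}=A(\mathcal{S},\mathcal{S})-D_{\mathcal{S},\mathcal{R}}D_{\mathcal{R},\mathcal{R}}^{-1}D_{\mathcal{R},\mathcal{S}}$ and matrices $U_{\mathcal{I}},V_{\mathcal{I}}$ (products of block unit-triangular matrices: $Q$ times the elimination matrices) such that $U_{\mathcal{I}}^*AV_{\mathcal{I}}$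 is approximately $A$ with the $(\mathcal{S},\mathcal{S})$ and $(\mathcal{R},\mathcal{R})$ blocks replaced by $D_{\mathcal{S},\mathcal{S}},D_{\mathcal{R},\mathcal{R}}$ and all other blocks involving $\mathcal{R}$ replaced by zero. When skeletonizing box $b$, the far interactions with $\mathcal{F}_b$ in the ID are replaced by interactions with a small number of points on a proxy surface around $b$, so skeletonizing $b$ uses only the entries of the current matrix with indices in $\mathcal{I}_b\cup\mathcal{N}_b$. **Recursive skeletonization factorization of $G$.** Set $G_L=G$. For $\ell=L,\dots,1$: skeletonize $G_\ell$ independently with respect to every $\mathcal{I}_b\in\mathscr{L}_\ell$, obtaining $\mathcal{S}_b,\mathcal{R}_b,D_{\mathcal{S}_b,\mathcal{S}_b},D_{\mathcal{R}_b,\mathcal{R}_b},U_{\mathcal{I}_b},V_{\mathcal{I}_b}$; put $U_{\mathscr{L}_\ell}=\prod_b U_{\mathcal{I}_b}$, $V_{\mathscr{L}_\ell}=\prod_b V_{\mathcal{I}_b}$; and form $G_{\ell-1}$ from $G_\ell$ by zeroing the rows and columns $\mathcal{R}_b$ and then setting the $(\mathcal{S}_b,\mathcal{S}_b)$ and $(\mathcal{R}_b,\mathcal{R}_b)$ blocks to $D_{\mathcal{S}_b,\mathcal{S}_b}$, $D_{\mathcal{R}_b,\mathcal{R}_b}$. The factorization is $G\approx U_{\mathscr{L}_L}^{-*}\cdots U_{\mathscr{L}_1}^{-*}G_0V_{\mathscr{L}_1}^{-1}\cdots V_{\mathscr{L}_L}^{-1}$, stored in block form (the large matrices are never assembled).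 **Marked boxes.** $\mathscr{M}_L=\{b\text{ on level }L:\bar G(\mathcal{F}_b^c,\mathcal{F}_b^c)\ne G(\mathcal{F}_b^c,\mathcal{F}_b^c)\}$. For $1\le\ell<L$: $\mathscr{P}_\ell$ is the set of parents of boxes in $\mathscr{M}_{\ell+1}$; $\mathscr{U}_\ell$ is the set of boxes $b'$ on level $\ell$ having some $b\in\mathscr{P}_\ell$ in $\mathrm{nbor}(b')$; and $\mathscr{M}_\ell=\{b\text{ on level }\ell:\bar G(\mathcal{F}_b^c,\mathcal{F}_b^c)\ne G(\mathcal{F}_b^c,\mathcal{F}_b^c)\}\cup\mathscr{P}_\ell\cup\mathscr{U}_\ell$ (the first set covers leaf boxes on levels $\ell<L$ that are directly modified). **Updating algorithm.** For $\ell=L,\dots,1$: determine $\mathscr{M}_\ell$; for each box in $\mathscr{M}_\ell$ recompute the skeletonization output for $\bar G_\ell$; for every other box on level $\ell$ reuse the stored output from the factorization of $G$. Assembly of the matrices $\bar G_{\ell-1}$ is purely notational and not performed. **Cost model.** $k_\ell$ is a bound, independent of $b$, on the number of skeleton DOFs $|\mathcal{S}_b|$ and $|\bar{\mathcal{S}}_b|$ for boxes $b$ on level $\ell$. The cost of skeletonizing one box on level $\ell$ is dominated by the ID and is $\mathcal{O}(k_\ell^3)$ (with $k_\ell$ taken to be at least $1$). Complexity means the total cost of the skeletonizations recomputed by the updating algorithm.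
   Formalization: Added assumption: each leaf box containing DOFs lies in nbor(b') for at most κ boxes b' of any one level, the constant depending on κ; without it one coarse leaf may touch order N finest boxes, so changing it (m=1) marks them all and the bound fails. *)

(* Defs.v *)
From HB Require Import structures.
From mathcomp Require Import all_boot all_order all_algebra.
From mathcomp Require Import complex.
From mathcomp Require Import all_classical all_reals all_analysis.
Import Order.TTheory GRing.Theory Num.Theory.
Import numFieldNormedType.Exports.

Set Implicit Arguments.
Unset Strict Implicit.
Unset Printing Implicit Defensive.

Local Open Scope ring_scope.
Local Open Scope complex_scope.
Local Open Scope sesquilinear_scope.

Section Submatrices.
Variables (R : realType) (N : nat).
Implicit Types (I J : {set 'I_N}).

(* A(:, J) and A(I, J), with I and J enumerated in increasing order. *)
Definition cols q (A : 'M[R[i]]_(q, N)) J : 'M[R[i]]_(q, #|J|) :=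
  colsub (fun b : 'I_#|J| => enum_val b) A.

Definition subblock (A : 'M[R[i]]_N) I J : 'M[R[i]]_(#|I|, #|J|) :=
  mxsub (fun a : 'I_#|I| => enum_val a) (fun b : 'I_#|J| => enum_val b) A.

(* The N x N matrix whose (I, J) block is B and which vanishes elsewhere. *)
Definition embed I J (B : 'M[R[i]]_(#|I|, #|J|)) : 'M[R[i]]_N :=
  (rowsub (fun a : 'I_#|I| => enum_val a) 1%:M)^T *m B *m
  rowsub (fun b : 'I_#|J| => enum_val b) 1%:M.

Definition set_block (A : 'M[R[i]]_N) I J (B : 'M[R[i]]_(#|I|, #|J|)) :=
  A + embed (B - subblock A I J).

End Submatrices.

Definition vnorm2 (R : realType) n (v : 'cV[R[i]]_n) : R :=
  Num.sqrt (\sum_j (complex.Re (v j 0) ^+ 2 + complex.Im (v j 0) ^+ 2)).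

Definition opnorm2 (R : realType) m n (A : 'M[R[i]]_(m, n)) : R :=
  sup [set r | exists2 v : 'cV[R[i]]_n, vnorm2 v <= 1 & r = vnorm2 (A *m v)]%classic.

(* (l, i, j) is the box in column i and row j of the 2^l x 2^l grid of level *)
(* l; the positions that lie outside this grid are excluded by the field    *)
(* qt_grid below.                                                           *)
Definition box (L : nat) : finType := ('I_L.+1 * 'I_(2 ^ L) * 'I_(2 ^ L))%type.

Section Boxes.
Variable L : nat.
Implicit Types (b p : box L) (B : {set box L}).

Definition level b : nat := b.1.1.
Definition xpos b : nat := b.1.2.
Definition ypos b : nat := b.2.

Definition is_parent p b : bool :=
  [&& level b == (level p).+1, xpos p == (xpos b)./2 & ypos p == (ypos b)./2].

Definition child B p : {set box L} := [set b in B | is_parent p b].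
Definition leaf B b : bool := (b \in B) && (child B b == finset.set0).

End Boxes.

Definition square (R : realType) (o : R * R) (s : R) : set (R * R) :=
  [set z | o.1 <= z.1 <= o.1 + s /\ o.2 <= z.2 <= o.2 + s]%classic.

Definition cell (R : realType) (o : R * R) (s : R) L (b : box L) : set (R * R) :=
  let h := s / 2 ^+ level b in
  square (o.1 + (xpos b)%:R * h, o.2 + (ypos b)%:R * h) h.

(* An adaptive quadtree with levels 0, ..., L over N points of the plane.    *)
(* - A box that is not a leaf need not have all four children: discarding    *)
(*   the children that contain no DOF is allowed.                            *)
(* - qt_loc i is the leaf in which DOF i is located; for a point on an edge  *)
(*   shared by several leaves, any of them may be chosen.                    *)
Record quadtree (R : realType) (N L : nat) := Quadtree {
  qt_corner : R * R;
  qt_side : R;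
  qt_boxes : {set box L};
  qt_point : 'I_N -> R * R;
  qt_loc : 'I_N -> box L;
  qt_side_gt0 : 0 < qt_side;
  qt_grid : forall b, b \in qt_boxes ->
    (xpos b < 2 ^ level b)%N /\ (ypos b < 2 ^ level b)%N;
  qt_parent : forall b, b \in qt_boxes -> (0 < level b)%N ->
    exists2 p, p \in qt_boxes & is_parent p b;
  qt_depth : exists2 b, b \in qt_boxes & level b = L;
  qt_loc_leaf : forall i, leaf qt_boxes (qt_loc i);
  qt_loc_cell : forall i, cell qt_corner qt_side (qt_loc i) (qt_point i)
}.

Section Tree.
Variables (R : realType) (N L : nat) (Q : quadtree R N L).
Implicit Types (b : box L).

Definition qcell b : set (R * R) := cell (qt_corner Q) (qt_side Q) b.

Definition adjacent_boxes b b' : Prop :=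
  [/\ b <> b',
      (interior (qcell b) `&` interior (qcell b') = set0)%classic &
      (closure (qcell b) `&` closure (qcell b') !=set0)%classic].

Definition nbor b : {set box L} :=
  [set b' in qt_boxes Q | `[< adjacent_boxes b b' >] &&
     ((level b' == level b) ||
      (level b' < level b)%N && leaf (qt_boxes Q) b')].

Definition on_level (l : nat) : {set box L} :=
  [set b in qt_boxes Q | level b == l].

Definition leaf_dofs b : {set 'I_N} := [set i | qt_loc Q i == b].

(* The sets I_b, N_b, F_b^c = I_b U N_b, given the skeletons S of the boxes. *)
Definition active_dofs (S : box L -> {set 'I_N}) b : {set 'I_N} :=
  if leaf (qt_boxes Q) b then leaf_dofs b
  else \bigcup_(b' in child (qt_boxes Q) b) S b'.

Definition near_dofs (S : box L -> {set 'I_N}) b : {set 'I_N} :=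
  \bigcup_(b' in nbor b) active_dofs S b'.

Definition farC_dofs (S : box L -> {set 'I_N}) b : {set 'I_N} :=
  active_dofs S b :|: near_dofs S b.

(* Every leaf containing a DOF belongs to nbor b' for at most kappa boxes b' *)
(* of any one level. Only levels finer than that of the leaf matter: on its  *)
(* own level there are at most eight such boxes, on coarser levels none.     *)
(* Nothing else prevents a coarse leaf from touching a number of fine boxes  *)
(* of the order of N, which are all marked when the leaf is modified.        *)
(* If refined boxes keep all four children and adjacent leaves differ by at  *)
(* most one level, then kappa = 12 will do.                                  *)
Definition locally_bounded (kappa : nat) : Prop :=
  forall b (l : nat), leaf (qt_boxes Q) b -> leaf_dofs b != finset.set0 ->
    (#|[set b' in on_level l | b \in nbor b']| <= kappa)%N.

End Tree.

Record skel_output (R : realType) (N : nat) := SkelOutput {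
  skS : {set 'I_N};
  skR : {set 'I_N};
  skT : 'M[R[i]]_(#|skS|, #|skR|);
  skDS : 'M[R[i]]_#|skS|;
  skDR : 'M[R[i]]_#|skR|;
  skU : 'M[R[i]]_N;
  skV : 'M[R[i]]_N
}.

Section Skeletonization.
Variables (R : realType) (N : nat).
Implicit Types (I J S : {set 'I_N}) (A : 'M[R[i]]_N).

(* (S, P, T) is an eps-accurate ID of the matrix X(:, I). *)
Definition is_ID (eps : R) q (X : 'M[R[i]]_(q, N)) I S (P : {set 'I_N})
    (T : 'M[R[i]]_(#|S|, #|P|)) : Prop :=
  [/\ S :|: P = I, [disjoint S & P] &
      opnorm2 (cols X P - cols X S *m T) <= eps * opnorm2 (cols X I)].

(* The matrix whose columns I are compressed when a box with active DOFs I   *)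
(* and near DOFs J is skeletonized: A(J, I) stacked on A(I, J)^* and on the  *)
(* interactions Y of the DOFs with the proxy points (incoming and outgoing), *)
(* which stand for A(F, I) and A(I, F)^*.                                    *)
Definition local_stack A J p (Y : 'M[R[i]]_(p, N)) :
    'M[R[i]]_(#|J| + (#|J| + p), N) :=
  col_mx (rowsub (fun a : 'I_#|J| => enum_val a) A)
    (col_mx (rowsub (fun a : 'I_#|J| => enum_val a) (A ^t*)) Y).

Definition skeletonizes (eps : R) A I J p (Y : 'M[R[i]]_(p, N))
    (o : skel_output R N) : Prop :=
  let S := skS o in
  let P := skR o in
  let Q := 1%:M - embed (skT o) in
  let B := Q ^t* *m A *m Q in
  let DSR := subblock B S P in
  let DRS := subblock B P S in
  let DRR := subblock B P P in
  [/\ is_ID eps (local_stack A J Y) I (skT o),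
      DRR \in unitmx /\ skDR o = DRR,
      skDS o = subblock A S S - DSR *m invmx DRR *m DRS,
      skU o = Q *m (1%:M - embed ((DSR *m invmx DRR) ^t*)) &
      skV o = Q *m (1%:M - embed (invmx DRR *m DRS))].

End Skeletonization.

(* rs_out b is the stored output for box b (of level >= 1); rs_mat l is the  *)
(* matrix G_l.                                                               *)
Record rsf (R : realType) (N L : nat) := Rsf {
  rs_out : box L -> skel_output R N;
  rs_mat : nat -> 'M[R[i]]_N
}.

Section Factorization.
Variables (R : realType) (N L : nat) (Q : quadtree R N L).
Implicit Types (A : 'M[R[i]]_N) (out : box L -> skel_output R N) (F : rsf R N L).

Definition skel F (b : box L) : {set 'I_N} := skS (rs_out F b).

(* G_(l-1) from A = G_l. The index sets of distinct boxes of a level are     *)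
(* disjoint, so the order in which the blocks are set is irrelevant.         *)
Definition assemble out (l : nat) A : 'M[R[i]]_N :=
  let P := \bigcup_(b in on_level Q l) skR (out b) in
  foldr (fun b M => set_block (set_block M (skDS (out b))) (skDR (out b)))
    (\matrix_(i, j) (if (i \in P) || (j \in P) then 0 else A i j))
    (enum (on_level Q l)).

(* Y b holds the proxy interactions used for box b. *)
Definition skeletonizes_box (eps : R) p (Y : box L -> 'M[R[i]]_(p, N)) F
    (b : box L) : Prop :=
  skeletonizes eps (rs_mat F (level b)) (active_dofs Q (skel F) b)
    (near_dofs Q (skel F) b) (Y b) (rs_out F b).

Definition is_rsf (eps : R) p (Y : box L -> 'M[R[i]]_(p, N)) (G : 'M[R[i]]_N) F :
    Prop :=
  rs_mat F L = G /\
  forall l, (1 <= l <= L)%N ->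
    (forall b, b \in on_level Q l -> skeletonizes_box eps Y F b) /\
    rs_mat F l.-1 = assemble (rs_out F) l (rs_mat F l).

Section Marking.
Variables (G G' : 'M[R[i]]_N) (F : rsf R N L).

Definition directly_marked (l : nat) : {set box L} :=
  [set b in on_level Q l |
     subblock G' (farC_dofs Q (skel F) b) (farC_dofs Q (skel F) b)
       != subblock G (farC_dofs Q (skel F) b) (farC_dofs Q (skel F) b)].

Definition parents (M : {set box L}) : {set box L} :=
  [set p in qt_boxes Q | [exists b in M, is_parent p b]].

Definition nbor_marked (l : nat) (M : {set box L}) : {set box L} :=
  [set b' in on_level Q l | [exists b in M, b \in nbor Q b']].

(* The marked boxes of level L - d. *)
Fixpoint marked_from_bottom (d : nat) : {set box L} :=
  if d is d'.+1 then
    let P := parents (marked_from_bottom d') in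
    directly_marked (L - d) :|: P :|: nbor_marked (L - d) P
  else directly_marked L.

Definition marked (l : nat) : {set box L} := marked_from_bottom (L - l).

End Marking.

(* F' is the result of running the updating algorithm for G' from the        *)
(* factorization F of G.                                                     *)
Definition is_update (eps : R) p (Y' : box L -> 'M[R[i]]_(p, N))
    (G G' : 'M[R[i]]_N) F F' : Prop :=
  rs_mat F' L = G' /\
  forall l, (1 <= l <= L)%N ->
    (forall b, b \in on_level Q l ->
       if b \in marked G G' F l then skeletonizes_box eps Y' F' b
       else rs_out F' b = rs_out F b) /\
    rs_mat F' l.-1 = assemble (rs_out F') l (rs_mat F' l).

(* cost b is the cost of (re)computing the skeletonization of box b. *)
Definition update_cost (G G' : 'M[R[i]]_N) F (cost : box L -> R) : R :=
  \sum_(1 <= l < L.+1) \sum_(b in marked G G' F l) cost b.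

End Factorization.

(* Main.v *)
(* Only boxes close to a modified leaf a are marked. Measure the distance of a
   level-l box from a in units of level-l boxes. The active DOFs of a box lie in
   leaves below it, so a directly marked box touches a nonempty modified leaf
   (distance at most 1). Passing to parents halves distances and marking
   neighbors adds 1 to them, so "distance at most 2" is stable from each level
   to the next coarser one: every marked box is equal or adjacent to a tree box
   touching some a. At most 9 boxes of a level not finer than a touch a; the
   touching boxes of a finer level have the leaf a in nbor, so there are at most
   kappa of them. Hence a level has at most 9 (9 + kappa) m marked boxes, and the
   cost is at most a constant times the sum of m (1 + L - l)^3 over 1 <= l <= L,
   which is at most m L^4. *)
Require Import Defs.
From HB Require Import structures.
From mathcomp Require Import all_boot all_order all_algebra.
From mathcomp Require Import complex.
From mathcomp Require Import all_classical all_reals all_analysis.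
From mathcomp Require Import zify ring lra.
Import Order.TTheory GRing.Theory Num.Theory.
Import numFieldNormedType.Exports.

Set Implicit Arguments.
Unset Strict Implicit.
Unset Printing Implicit Defensive.

Local Open Scope ring_scope.
Local Open Scope complex_scope.

(** * Dyadic intervals across levels *)

(* The intervals of level [l] that meet the interior of the interval [x] of   *)
(* level [la] are those from [lo la l x] to [hi la l x]. One of the truncated *)
(* differences [l - la] and [la - l] is zero.                                 *)
Definition lo (la l x : nat) : nat := (x * 2 ^ (l - la) %/ 2 ^ (la - l))%N.
Definition hi (la l x : nat) : nat :=
  ((x.+1 * 2 ^ (l - la)).-1 %/ 2 ^ (la - l))%N.

(** Coarsening by one level adds a factor 2 to the divisor or removes one from the multiplier: one
    halving either way. *)
Lemma lo_half la l x : lo la l x = (lo la l.+1 x)./2.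
Proof.
rewrite /lo -divn2; case: (ltnP l la) => h.
  have -> : (l - la = 0)%N by lia.
  have -> : (l.+1 - la = 0)%N by lia.
  have -> : (la - l = (la - l.+1).+1)%N by lia.
  by rewrite -divnMA expnSr.
have -> : (la - l = 0)%N by lia.
have -> : (la - l.+1 = 0)%N by lia.
by rewrite subSn // expnS expn0 !divn1 mulnCA mulKn.
Qed.

Lemma hi_half la l x : hi la l x = (hi la l.+1 x)./2.
Proof.
rewrite /hi -divn2; case: (ltnP l la) => h.
  have -> : (l - la = 0)%N by lia.
  have -> : (l.+1 - la = 0)%N by lia.
  have -> : (la - l = (la - l.+1).+1)%N by lia.
  by rewrite -divnMA expnSr.
have -> : (la - l = 0)%N by lia.
have -> : (la - l.+1 = 0)%N by lia.
rewrite subSn // expnS expn0 !divn1 mulnCA.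
have : (0 < x.+1 * 2 ^ (l - la))%N by rewrite muln_gt0 expn_gt0.
(* For [y > 0], halving [2y - 1] and rounding down gives [y - 1]. *)
by move: (_ * _)%N => y; lia.
Qed.

Lemma lo_fine la l x : (la <= l)%N -> lo la l x = (x * 2 ^ (l - la))%N.
Proof. by rewrite /lo => /eqP ->; rewrite divn1. Qed.

Lemma hi_fine la l x : (la <= l)%N -> hi la l x = (x.+1 * 2 ^ (l - la)).-1.
Proof. by rewrite /hi => /eqP ->; rewrite divn1. Qed.

Lemma lo_coarse la l x : (l <= la)%N -> lo la l x = (x %/ 2 ^ (la - l))%N.
Proof. by rewrite /lo => /eqP ->; rewrite muln1. Qed.

Lemma hi_coarse la l x : (l <= la)%N -> hi la l x = (x %/ 2 ^ (la - l))%N.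
Proof. by rewrite /hi => /eqP ->; rewrite muln1. Qed.

Lemma card_bigcup_le (I T : finType) (A : {set I}) (B : I -> {set T}) n :
  (forall x, x \in A -> (#|B x| <= n)%N) ->
  (#|\bigcup_(x in A) B x| <= #|A| * n)%N.
Proof.
move=> hB; rewrite -sum_nat_const.
elim/big_ind2: _ => // [|X s Y t hX hY]; first by rewrite cards0.
by apply: leq_trans (leq_card_setU _ _) (leq_add hX hY).
Qed.

(** * Chebyshev distance between grid boxes *)

Section GridBoxes.
Variable L : nat.
Implicit Types (a b p : box L) (d : nat).

(* Chebyshev distance, counted in boxes of the level of [b]. When [a] is not  *)
(* finer than [b], 0 means that the interiors meet, 1 that the closures meet. *)
Definition within_dist d a b : bool :=
  [&& lo (level a) (level b) (xpos a) <= xpos b + d,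
      xpos b <= hi (level a) (level b) (xpos a) + d,
      lo (level a) (level b) (ypos a) <= ypos b + d &
      ypos b <= hi (level a) (level b) (ypos a) + d]%N.

Lemma within_dist_coarse d a b : (level b <= level a)%N ->
  within_dist d a b =
  [&& xpos a %/ 2 ^ (level a - level b) <= xpos b + d,
      xpos b <= xpos a %/ 2 ^ (level a - level b) + d,
      ypos a %/ 2 ^ (level a - level b) <= ypos b + d &
      ypos b <= ypos a %/ 2 ^ (level a - level b) + d]%N.
Proof. by move=> h; rewrite /within_dist !(lo_coarse, hi_coarse). Qed.

Lemma within_dist_same d a b : level b = level a ->
  within_dist d a b =
  [&& xpos a <= xpos b + d, xpos b <= xpos a + d,
      ypos a <= ypos b + d & ypos b <= ypos a + d]%N.
Proof. by move=> h; rewrite within_dist_coarse ?h // subnn !divn1. Qed.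

Lemma within_dist_trans d a p b : level b = level p ->
  within_dist d a p -> within_dist 1 p b -> within_dist d.+1 a b.
Proof.
move=> h; rewrite (within_dist_same _ h) /within_dist h.
by move=> /and4P[? ? ? ?] /and4P[? ? ? ?]; apply/and4P; split; lia.
Qed.

(** The contraction step: [lo] and [hi] commute with halving, and an offset of 2 becomes an offset
    of 1. *)
Lemma within_dist_parent a p b :
  is_parent p b -> within_dist 2 a b -> within_dist 1 a p.
Proof.
move=> /and3P[/eqP hl /eqP hx /eqP hy]; rewrite /within_dist hl hx hy.
rewrite !(lo_half _ (level p)) !(hi_half _ (level p)).
by move=> /and4P[? ? ? ?]; apply/and4P; split; lia.
Qed.

Lemma box_eq b b' : level b = level b' -> xpos b = xpos b' ->
  ypos b = ypos b' -> b = b'.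
Proof.
case: b b' => [[i x] y] [[i' x'] y'].
by move=> /ord_inj /= -> /ord_inj /= -> /ord_inj /= ->.
Qed.

Lemma card_window (l u v : nat) :
  (#|[set b : box L | (level b == l) &&
       [&& u <= xpos b + 1, xpos b <= u + 1,
           v <= ypos b + 1 & ypos b <= v + 1]%N]| <= 9)%N.
Proof.
(* The added 1 keeps the truncated differences exact: on [W] they are 0, 1 or 2 and determine the
   box. *)
pose f b : 'I_3 * 'I_3 := (inord (xpos b + 1 - u), inord (ypos b + 1 - v)).
set W := finset _.
have -> : 9%N = #|{: 'I_3 * 'I_3}| by rewrite card_prod !card_ord.
apply: (@leq_trans #|f @: W|); last exact: max_card.
rewrite card_in_imset // => b b'.
rewrite !inE => /andP[/eqP hl /and4P[? ? ? ?]] /andP[/eqP hl' /and4P[? ? ? ?]].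
case=> /(congr1 val) /= hx /(congr1 val) /= hy.
move: hx hy; rewrite !inordK; try lia.
by move=> hx hy; apply: box_eq; [rewrite hl|lia|lia].
Qed.

End GridBoxes.

(** * Interiors of planar sets on either side of a line *)

Section PlaneTopology.
Variable R : realType.
Implicit Types (A B : set (R * R)).
Local Open Scope classical_set_scope.

Lemma closed_square (o : R * R) (s : R) : closed (square o s).
Proof.
have -> : square o s =
    (fst @^-1` `[o.1, o.1 + s]) `&` (snd @^-1` `[o.2, o.2 + s]).
  by apply/seteqP; split => z /=; rewrite !in_itv.
apply: closedI; apply: closed_comp => [z _|].
- exact: cvg_fst.
- exact: interval_closed.
- exact: cvg_snd.
- exact: interval_closed.
Qed.

(** Near a common interior point every first coordinate would have to be [t], yet a shift by [e / 2]
    stays in the neighborhood. *)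
Lemma interior_disjoint_fst A B (t : R) :
  (forall z, A z -> z.1 <= t) -> (forall z, B z -> t <= z.1) ->
  interior A `&` interior B = set0.
Proof.
move=> hA hB; apply/seteqP; split => // z [zA zB].
have [[P P'] [/= zP zP'] sub] : nbhs z (A `&` B) by exact: filterI.
have [e /= e0 he] : nbhs z.1 P by [].
have zt (y : R) : P y -> y = t.
  move=> yP.
  have [/hA /= ? /hB /= ?] := sub (y, z.2) (conj yP (nbhs_singleton zP')).
  by apply/eqP; rewrite eq_le; apply/andP.
have h1 := zt _ (nbhs_singleton zP).
have h2 : z.1 + e / 2 = t.
  apply/zt/he; rewrite /= opprD addNKr normrN gtr0_norm ?divr_gt0 //.
  by rewrite ltr_pdivrMr // ltr_pMr // ltr1n.
by move: e0; lra.
Qed.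

Lemma interior_disjoint_snd A B (t : R) :
  (forall z, A z -> z.2 <= t) -> (forall z, B z -> t <= z.2) ->
  interior A `&` interior B = set0.
Proof.
move=> hA hB; apply/seteqP; split => // z [zA zB].
have [[P' P] [/= zP' zP] sub] : nbhs z (A `&` B) by exact: filterI.
have [e /= e0 he] : nbhs z.2 P by [].
have zt (y : R) : P y -> y = t.
  move=> yP.
  have [/hA /= ? /hB /= ?] := sub (z.1, y) (conj (nbhs_singleton zP') yP).
  by apply/eqP; rewrite eq_le; apply/andP.
have h1 := zt _ (nbhs_singleton zP).
have h2 : z.2 + e / 2 = t.
  apply/zt/he; rewrite /= opprD addNKr normrN gtr0_norm ?divr_gt0 //.
  by rewrite ltr_pdivrMr // ltr_pMr // ltr1n.
by move: e0; lra.
Qed.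

End PlaneTopology.

(** * Cells, grid distance and neighbors in the quadtree *)

Section TreeGeometry.
Variables (R : realType) (N L : nat) (Q : quadtree R N L).
Implicit Types (a b p : box L).

Let mesh (l : nat) : R := qt_side Q / 2 ^+ l.

Lemma mesh_gt0 l : 0 < mesh l.
Proof. by rewrite divr_gt0 ?qt_side_gt0 ?exprn_gt0. Qed.

Lemma mesh_refine l l' : (l <= l')%N -> mesh l = (2 ^ (l' - l))%:R * mesh l'.
Proof.
move=> /subnK {2}<-; rewrite /mesh natrX exprD.
by field; rewrite !expf_neq0.
Qed.

(** Comparing grid lines of two levels becomes integer arithmetic in units of the finer mesh. *)
Lemma mesh_le (c : R) x l y l' : (l <= l')%N ->
  (c + x%:R * mesh l <= c + y%:R * mesh l') = (x * 2 ^ (l' - l) <= y)%N.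
Proof.
move=> h; rewrite lerD2l (mesh_refine h) mulrA -natrM.
by rewrite ler_pM2r ?mesh_gt0 // ler_nat.
Qed.

Lemma mesh_ge (c : R) x l y l' : (l <= l')%N ->
  (c + y%:R * mesh l' <= c + x%:R * mesh l) = (y <= x * 2 ^ (l' - l))%N.
Proof.
move=> h; rewrite lerD2l (mesh_refine h) mulrA -natrM.
by rewrite ler_pM2r ?mesh_gt0 // ler_nat.
Qed.

Lemma qcellE b : qcell Q b =
  [set z | (qt_corner Q).1 + (xpos b)%:R * mesh (level b) <= z.1 <=
             (qt_corner Q).1 + (xpos b).+1%:R * mesh (level b) /\
           (qt_corner Q).2 + (ypos b)%:R * mesh (level b) <= z.2 <=
             (qt_corner Q).2 + (ypos b).+1%:R * mesh (level b)]%classic.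
Proof.
rewrite /qcell /cell /square /= -!addrA -/(mesh _).
by rewrite -!natr1 !mulrDl !mul1r.
Qed.

Lemma touching_within_dist a b : (level a <= level b)%N ->
  (closure (qcell Q b) `&` closure (qcell Q a) !=set0)%classic ->
  within_dist 1 a b.
Proof.
move=> h [z []].
have cl c : closure (qcell Q c) = qcell Q c.
  exact/esym/closure_id/closed_square.
rewrite !cl !qcellE /=.
move=> -[/andP[b1 b2] /andP[b3 b4]] [/andP[a1 a2] /andP[a3 a4]].
rewrite /within_dist !lo_fine // !hi_fine //.
have := le_trans b1 a2; have := le_trans a1 b2.
have := le_trans b3 a4; have := le_trans a3 b4.
rewrite !(mesh_le _ _ _ h) !(mesh_ge _ _ _ h) => ? ? ? ?.
have ? : (0 < 2 ^ (level b - level a))%N by rewrite expn_gt0.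
by apply/and4P; split; lia.
Qed.

Lemma within_dist_touching a b : (level a <= level b)%N ->
  within_dist 1 a b ->
  (closure (qcell Q b) `&` closure (qcell Q a) !=set0)%classic.
Proof.
move=> h; rewrite /within_dist !lo_fine // !hi_fine //.
have ? : (0 < 2 ^ (level b - level a))%N by rewrite expn_gt0.
move=> /and4P[x1 x2 y1 y2].
pose o := qt_corner Q.
(* The componentwise maximum of the two lower corners lies in both cells. *)
exists (Num.max (o.1 + (xpos b)%:R * mesh (level b))
                (o.1 + (xpos a)%:R * mesh (level a)),
        Num.max (o.2 + (ypos b)%:R * mesh (level b))
                (o.2 + (ypos a)%:R * mesh (level a))).
have mono (c : R) x l : c + x%:R * mesh l <= c + x.+1%:R * mesh l.
  by rewrite lerD2l ler_pM2r ?mesh_gt0 // ler_nat.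
by split; apply: subset_closure; rewrite qcellE /=; split;
  rewrite le_max ge_max lexx ?orbT /= ?mono ?andbT //=
    ?(mesh_le _ _ _ h) ?(mesh_ge _ _ _ h); lia.
Qed.

(** The grid ancestor of [b] on the level of [a] is not [a], so a line through a side of one of the
    cells separates them. *)
Lemma interior_disjoint a b : (level a <= level b)%N ->
  (xpos b %/ 2 ^ (level b - level a) != xpos a)%N ||
  (ypos b %/ 2 ^ (level b - level a) != ypos a)%N ->
  (interior (qcell Q b) `&` interior (qcell Q a) = set0)%classic.
Proof.
move=> h; have e0 : (0 < 2 ^ (level b - level a))%N by rewrite expn_gt0.
have sep u v : (u %/ 2 ^ (level b - level a) != v)%N ->
    (u.+1 <= v * 2 ^ (level b - level a))%N \/
    (v.+1 * 2 ^ (level b - level a) <= u)%N.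
  rewrite neq_ltn => /orP[].
    by left; rewrite -ltn_divLR.
  by right; rewrite -leq_divRL.
case/orP => /sep [] hh.
- apply: (@interior_disjoint_fst _ _ _
    ((qt_corner Q).1 + (xpos a)%:R * mesh (level a))) => z;
    rewrite qcellE /= => -[/andP[z1 z2] _] //.
  by apply: (le_trans z2); rewrite mesh_ge.
- rewrite setIC; apply: (@interior_disjoint_fst _ _ _
    ((qt_corner Q).1 + (xpos b)%:R * mesh (level b))) => z;
    rewrite qcellE /= => -[/andP[z1 z2] _] //.
  by apply: (le_trans z2); rewrite mesh_le.
- apply: (@interior_disjoint_snd _ _ _
    ((qt_corner Q).2 + (ypos a)%:R * mesh (level a))) => z;
    rewrite qcellE /= => -[_ /andP[z1 z2]] //.
  by apply: (le_trans z2); rewrite mesh_ge.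
- rewrite setIC; apply: (@interior_disjoint_snd _ _ _
    ((qt_corner Q).2 + (ypos b)%:R * mesh (level b))) => z;
    rewrite qcellE /= => -[_ /andP[z1 z2]] //.
  by apply: (le_trans z2); rewrite mesh_le.
Qed.

Lemma mem_on_level l b : b \in on_level Q l -> b \in qt_boxes Q /\ level b = l.
Proof. by rewrite inE => /andP[-> /eqP]. Qed.

Lemma nbor_within_dist b b' : b' \in nbor Q b -> within_dist 1 b' b.
Proof.
rewrite inE => /andP[_ /andP[/asboolP[_ _ hc] hl]].
by apply: touching_within_dist hc; case/orP: hl => [/eqP->//|/andP[/ltnW]].
Qed.

(** Climbing through tree parents from a box inside [a] would reach a child of [a], which a leaf
    lacks. *)
Lemma leaf_no_descendant a b : leaf (qt_boxes Q) a -> b \in qt_boxes Q ->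
  (level a < level b)%N ->
  (xpos b %/ 2 ^ (level b - level a) != xpos a)%N ||
  (ypos b %/ 2 ^ (level b - level a) != ypos a)%N.
Proof.
move=> /andP[_ /eqP a0] hb hl; rewrite -negb_and; apply/negP => /andP[].
have [n hn] : exists n, (level b - level a)%N = n.+1.
  by exists (level b - level a).-1; lia.
elim: n b hb hl hn => [|n IH] b hb hl hn /eqP hx /eqP hy.
  have : b \in child (qt_boxes Q) a.
    rewrite inE hb /is_parent -hx -hy hn expn1 !divn2 !eqxx /= andbT.
    by apply/eqP; lia.
  by rewrite a0 inE.
have [|p hp /and3P[/eqP pl /eqP px /eqP py]] := qt_parent hb; first by lia.
have hpn : (level p - level a)%N = n.+1 by lia.
apply: (IH p hp) => //; first by lia.
- by apply/eqP; rewrite -hx px hn hpn (expnS _ n.+1) divnMA divn2.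
- by apply/eqP; rewrite -hy py hn hpn (expnS _ n.+1) divnMA divn2.
Qed.

(** Lets [locally_bounded] count the finer boxes touching a leaf: having no descendants, the leaf is
    adjacent to each of them. *)
Lemma leaf_in_nbor a b : leaf (qt_boxes Q) a -> b \in qt_boxes Q ->
  (level a < level b)%N -> within_dist 1 a b -> a \in nbor Q b.
Proof.
move=> la hb hl hd; rewrite inE; case/andP: (la) => -> _ /=.
rewrite la hl orbT andbT; apply/asboolP; split.
- by move=> e; rewrite e ltnn in hl.
- by apply: interior_disjoint (ltnW hl) _; apply: leaf_no_descendant.
- exact: within_dist_touching (ltnW hl) hd.
Qed.

(** * Boxes touching a leaf, and the location of active DOFs *)

Definition touching (l : nat) a : {set box L} :=
  [set b in on_level Q l | within_dist 1 a b].

(** Boxes not finer than [a] lie in a 3 by 3 window around its ancestor; finer ones have [a] in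
    [nbor], so [kappa] bounds them. *)
Lemma card_touching kappa l a : locally_bounded Q kappa ->
  leaf (qt_boxes Q) a -> leaf_dofs Q a != finset.set0 ->
  (#|touching l a| <= 9 + kappa)%N.
Proof.
move=> hk la a0; case: (leqP l (level a)) => hl.
  apply: leq_trans (leq_addr _ _).
  apply: leq_trans (card_window L l (xpos a %/ 2 ^ (level a - l))
                                    (ypos a %/ 2 ^ (level a - l))).
  apply/subset_leq_card/fintype.subsetP => b.
  rewrite !inE => /andP[/andP[_ /eqP e]].
  by rewrite -e eqxx within_dist_coarse ?e.
apply: leq_trans (leq_addl _ _); apply: leq_trans (hk a l la a0).
apply/subset_leq_card/fintype.subsetP => b.
rewrite [b \in touching _ _]inE => /andP[bl hd].
have [hb e] := mem_on_level bl; rewrite inE bl /=.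
by apply: leaf_in_nbor; rewrite ?e.
Qed.

(** Skeletons of children are active DOFs of children, so descending the tree ends in a leaf equal
    to [b] or below it. *)
Lemma active_dofs_sub (S : box L -> {set 'I_N}) :
  (forall b, b \in qt_boxes Q -> (1 <= level b)%N ->
     S b \subset active_dofs Q S b) ->
  forall i b, b \in qt_boxes Q -> i \in active_dofs Q S b ->
  (level b <= level (qt_loc Q i))%N /\ within_dist 0 (qt_loc Q i) b.
Proof.
move=> hS i b; have [n] := ubnP (L - level b).
elim: n b => // n IH b hn hb; rewrite /active_dofs; case: ifP => lb.
  rewrite inE => /eqP ->; split => //.
  by rewrite within_dist_same // !addn0 !leqnn.
move=> /bigcupP[b']; rewrite inE => /andP[hb' hp] hi.
case/and3P: (hp) => /eqP hl /eqP hx /eqP hy.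
have hL : (level b' <= L)%N by rewrite -ltnS; apply: ltn_ord.
have [||h1 h2] := IH b' _ hb'; first by lia.
  by apply: fintype.subsetP hi; apply: hS => //; rewrite hl.
have h3 : (level b <= level (qt_loc Q i))%N by lia.
split=> //; move: h2; rewrite !within_dist_coarse // hx hy.
have -> : (level (qt_loc Q i) - level b =
           (level (qt_loc Q i) - level b').+1)%N by lia.
rewrite expnSr !divnMA !divn2 => /and4P[*].
by apply/and4P; split; lia.
Qed.

End TreeGeometry.

(** * Propagation of marks through the levels *)

Section Marking.
Variables (R : realType) (N L : nat) (Q : quadtree R N L).
Variables (G G' : 'M[R[i]]_N) (F : rsf R N L) (modified : {set box L}).
Hypothesis skel_sub : forall b, b \in qt_boxes Q -> (1 <= level b)%N ->
  skel F b \subset active_dofs Q (skel F) b.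
Hypothesis unmodified : forall I I' : {set 'I_N},
  [disjoint I & \bigcup_(b in modified) leaf_dofs Q b] ->
  [disjoint I' & \bigcup_(b in modified) leaf_dofs Q b] ->
  subblock G' I I' = subblock G I I'.

(** Leaves without DOFs cause no direct marks, and [locally_bounded] says nothing about them. *)
Definition modified_nonempty : {set box L} :=
  [set a in modified | leaf_dofs Q a != finset.set0].

Lemma directly_marked_touching l b : b \in directly_marked Q G G' F l ->
  exists2 a, a \in modified_nonempty & b \in touching Q l a.
Proof.
rewrite inE => /andP[bl /eqP hne]; case: (pselect (exists2 i,
    i \in farC_dofs Q (skel F) b & qt_loc Q i \in modified)); last first.
  move=> hno; case: hne; apply: unmodified; apply/pred0P => i /=; apply/negP;
  move=> /andP[hi /bigcupP[a am]]; rewrite inE => /eqP ia;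
  by apply: hno; exists i; rewrite // ia.
move=> [i hi im]; exists (qt_loc Q i).
  by rewrite inE im; apply/set0Pn; exists i; rewrite inE.
have [hb lb] := mem_on_level bl.
rewrite inE bl /=; move: hi; rewrite inE.
move=> /orP[/(active_dofs_sub skel_sub hb)[h1]|].
  by rewrite !within_dist_coarse // => /and4P[*]; apply/and4P; split; lia.
move=> /bigcupP[b' hn hi]; have hd := nbor_within_dist hn.
move: hn; rewrite inE => /and3P[hb' _ /orP[/eqP e|/andP[_ leafb']]].
  have [_ h] := active_dofs_sub skel_sub hb' hi.
  exact: within_dist_trans (esym e) h hd.
(* A coarser neighbor is a leaf, hence the modified leaf itself, already at distance 1. *)
by move: hi; rewrite /active_dofs leafb' inE => /eqP ->.
Qed.

Lemma marked_on_level d : (d <= L)%N ->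
  {subset marked_from_bottom Q G G' F d <= on_level Q (L - d)}.
Proof.
elim: d => [_|d IH hd] b /=; first by rewrite subn0 inE => /andP[].
rewrite !finset.inE => /orP[/orP[]|]; try by case/andP.
move=> /andP[-> /existsP[b0 /andP[/(IH (ltnW hd))]]].
by rewrite !inE => /andP[_ /eqP h] /and3P[/eqP h' _ _]; apply/eqP; lia.
Qed.

(** The invariant keeps the intermediate tree box [p], not just distance 2 from [a], because
    [card_touching] counts only tree boxes at distance 1. *)
Lemma marked_near d b : (d <= L)%N -> b \in marked_from_bottom Q G G' F d ->
  exists2 a, a \in modified_nonempty &
  exists2 p, p \in touching Q (L - d) a & level b = level p /\ within_dist 1 p b.
Proof.
have direct l c : c \in directly_marked Q G G' F l ->
    exists2 a, a \in modified_nonempty &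
    exists2 p, p \in touching Q l a & level c = level p /\ within_dist 1 p c.
  move=> /directly_marked_touching[a ha hc]; exists a => //; exists c => //.
  by rewrite within_dist_same // !leq_addr.
elim: d b => [|d IH] b hd /=; first by rewrite subn0; apply: direct.
(* A marked box is within 1 + 1 of [a], so its parent is within 1 and can serve as the new
   intermediate box. *)
have par p : p \in parents Q (marked_from_bottom Q G G' F d) ->
    level p = (L - d.+1)%N /\
    exists2 a, a \in modified_nonempty & p \in touching Q (L - d.+1) a.
  rewrite inE => /andP[hp /existsP[b0 /andP[hb0 pb0]]].
  have [a ha [q]] := IH b0 (ltnW hd) hb0.
  rewrite inE => /andP[_ aq] [l0 qb0].
  have [_ e] := mem_on_level (marked_on_level (ltnW hd) hb0).
  case/and3P: (pb0) => /eqP h' _ _.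
  have lp : level p = (L - d.+1)%N by lia.
  split=> //; exists a => //; rewrite !finset.inE hp lp eqxx /=.
  exact: within_dist_parent pb0 (within_dist_trans l0 aq qb0).
rewrite !finset.in_setU => /orP[/orP[]|].
- exact: direct.
- move=> /par[_ [a ha hb]]; exists a => //; exists b => //.
  by rewrite within_dist_same // !leq_addr.
- rewrite inE => /andP[bl /existsP[p /andP[/par[lp [a ha hp]] hn]]].
  exists a => //; exists p => //; split; last exact: nbor_within_dist hn.
  by rewrite lp; case: (mem_on_level bl).
Qed.

Lemma card_marked kappa l : locally_bounded Q kappa ->
  (forall b, b \in modified -> leaf (qt_boxes Q) b) -> (l <= L)%N ->
  (#|marked Q G G' F l| <= #|modified| * ((9 + kappa) * 9))%N.
Proof.
move=> hk hleaf hl; rewrite /marked.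
(* [W p] takes all grid positions around [p], in the tree or not. *)
pose W (p : box L) := [set b : box L | (level b == level p) && within_dist 1 p b].
have cW p : (#|W p| <= 9)%N.
  apply: leq_trans (card_window L (level p) (xpos p) (ypos p)).
  apply/subset_leq_card/fintype.subsetP => b; rewrite !inE => /andP[/eqP e].
  by rewrite within_dist_same // e eqxx.
apply: (@leq_trans #|\bigcup_(a in modified_nonempty)
                       \bigcup_(p in touching Q l a) W p|).
  apply/subset_leq_card/fintype.subsetP => b hb.
  have [|a ha [p hp [e hd]]] := marked_near _ hb; first exact: leq_subr.
  apply/bigcupP; exists a => //; apply/bigcupP; exists p.
    by rewrite subKn in hp.
  by rewrite inE e eqxx.
apply: (@leq_trans (#|modified_nonempty| * ((9 + kappa) * 9))%N).
  apply: card_bigcup_le => a; rewrite inE => /andP[/hleaf am a0].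
  apply: (@leq_trans (#|touching Q l a| * 9)%N).
    by apply: card_bigcup_le => p _.
  by rewrite leq_mul2r card_touching.
rewrite leq_mul2r subset_leq_card ?orbT //.
by apply/fintype.subsetP => a; rewrite inE => /andP[].
Qed.

End Marking.

(** * Total cost of the update *)

Theorem theorem4p2 (R : realType) (nocc kappa : nat) (cL ck cID : R) :
  exists C : R,
  forall (N L : nat) (gamma : R -> R * R) (Q : quadtree R N L)
    (G Gbar : 'M[R[i]]_N) (eps : R) (p pbar : nat)
    (Y : box L -> 'M[R[i]]_(p, N)) (Ybar : box L -> 'M[R[i]]_(pbar, N))
    (F Fbar : rsf R N L) (k : nat -> nat) (cost : box L -> R)
    (m : nat) (modified : {set box L}),
  (1 < N)%N ->
  (* the domain is a curve, contained in the root square *)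
  {within `[0%R, 1%R], continuous gamma}%classic ->
  (gamma @` `[0%R, 1%R] `<=` square (qt_corner Q) (qt_side Q))%classic ->
  (forall i : 'I_N, (gamma @` `[0%R, 1%R])%classic (qt_point Q i)) ->
  (* the quadtree *)
  L%:R <= cL * ln (N%:R : R) ->
  (forall b, leaf (qt_boxes Q) b -> (#|leaf_dofs Q b| <= nocc)%N) ->
  locally_bounded Q kappa ->
  (* the given factorization of G and its update for Gbar *)
  0 < eps ->
  is_rsf Q eps Y G F ->
  is_update Q eps Ybar G Gbar F Fbar ->
  (* the number of skeletons *)
  (forall b, b \in qt_boxes Q -> (1 <= level b)%N ->
     (#|skel F b| <= k (level b))%N /\ (#|skel Fbar b| <= k (level b))%N) ->
  (forall l, (l <= L)%N ->
     (1 <= k l)%N /\ (k l)%:R <= ck * (1 + L - l)%N%:R) ->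
  (* the cost of skeletonizing one box *)
  (forall b, b \in qt_boxes Q -> (1 <= level b)%N ->
     0 <= cost b <= cID * (k (level b))%:R ^+ 3) ->
  (* the modified leaves *)
  #|modified| = m ->
  (forall b, b \in modified -> leaf (qt_boxes Q) b) ->
  (forall I I' : {set 'I_N},
     [disjoint I & \bigcup_(b in modified) leaf_dofs Q b] ->
     [disjoint I' & \bigcup_(b in modified) leaf_dofs Q b] ->
     subblock Gbar I I' = subblock G I I') ->
  update_cost Q G Gbar F cost <= C * m%:R * ln (N%:R : R) ^+ 4.
Proof.
(* Three powers of [cL] come from the cubed skeleton bound, the fourth from the number of levels;
   absolute values cover negative [cID] and [ck]. *)
exists (((9 + kappa) * 9)%:R * (`|cID| * `|ck| ^+ 3) * cL ^+ 4).
move=> N L gamma Q G Gbar eps p pbar Y Ybar F Fbar k cost m modified.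
move=> N1 _ _ _ hL _ hkappa _ [_ hF] _ _ hk hcost hm hleaf hmod.
have skel_sub b : b \in qt_boxes Q -> (1 <= level b)%N ->
    skel F b \subset active_dofs Q (skel F) b.
  move=> hb lb; have lL : (level b <= L)%N by rewrite -ltnS; apply: ltn_ord.
  have [|hs _] := hF (level b); first by rewrite lb lL.
  have [|[eqI _ _] _ _ _ _] := hs b; first by rewrite inE hb eqxx.
  by rewrite -eqI; exact: finset.subsetUl.
have level_cost l : (1 <= l < L.+1)%N ->
    \sum_(b in marked Q G Gbar F l) cost b <=
    m%:R * ((9 + kappa) * 9)%:R * (`|cID| * `|ck| ^+ 3 * L%:R ^+ 3).
  move=> /andP[l1 lL].
  have [k1 kl] := hk l lL.
  have c0 : 0 <= `|cID| * `|ck| ^+ 3 * L%:R ^+ 3 :> R.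
    by rewrite !mulr_ge0 ?exprn_ge0.
  apply: (@le_trans _ _ (\sum_(b in marked Q G Gbar F l)
      `|cID| * `|ck| ^+ 3 * L%:R ^+ 3)).
    apply: ler_sum => b hb.
    have := marked_on_level (leq_subr _ _) hb.
    rewrite subKn // => /mem_on_level[bq lb].
    have [|_] := andP (hcost b bq _); first by rewrite lb.
    move/le_trans; apply; rewrite lb -mulrA -exprMn.
    apply: (@le_trans _ _ (`|cID| * (k l)%:R ^+ 3)).
      by rewrite ler_wpM2r ?exprn_ge0 // ler_norm.
    rewrite ler_wpM2l // lerXn2r ?nnegrE ?mulr_ge0 //.
    apply: (le_trans kl); apply: (@le_trans _ _ (`|ck| * (1 + L - l)%:R)).
      by rewrite ler_wpM2r // ler_norm.
    (* Since [l >= 1], the factor [1 + L - l] is at most [L]. *)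
    by rewrite ler_wpM2l // ler_nat; lia.
  rewrite sumr_const -[leLHS]mulr_natl ler_wpM2r // -natrM ler_nat -hm.
  exact: card_marked.
rewrite /update_cost; apply: (@le_trans _ _ (\sum_(1 <= l < L.+1)
    m%:R * ((9 + kappa) * 9)%:R * (`|cID| * `|ck| ^+ 3 * L%:R ^+ 3))).
  by rewrite big_nat_cond [leRHS]big_nat_cond; apply: ler_sum => l /andP[/level_cost].
rewrite sumr_const_nat subn1 /= -[leLHS]mulr_natr.
set c := (_ * 9)%:R; set A := `|cID| * _.
have hL4 : L%:R ^+ 4 <= cL ^+ 4 * ln (N%:R : R) ^+ 4.
  by rewrite -exprMn lerXn2r ?nnegrE // (le_trans _ hL).
have -> : m%:R * c * (A * L%:R ^+ 3) * L%:R = c * A * m%:R * L%:R ^+ 4 by ring.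
have -> : c * A * cL ^+ 4 * m%:R * ln N%:R ^+ 4 =
  c * A * m%:R * (cL ^+ 4 * ln (N%:R : R) ^+ 4) by ring.
by rewrite ler_wpM2l // !mulr_ge0 ?exprn_ge0.
Qed.
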